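(* Let $\Sigma$ be a finite alphabet and let $L\subseteq\Sigma^*$ be a language recognized by some MM-1gQFA with bounded error $\epsilon$ for some $\epsilon>0$. Then $L$ is a regular language.
   Context: For a finite-dimensional complex Hilbert space $\mathcal{H}$, let $L(\mathcal{H})$ be the set of linear operators on $\mathcal{H}$. A density operator is a positive semidefinite operator of trace $1$; the support $\mathrm{supp}(A)$ of a positive operator $A$ is the span of its eigenvectors with nonzero eigenvalue. A trace-preserving quantum operation acting on $\mathcal{H}$ is a map $\mathcal{E}:L(\mathcal{H})\to L(\mathcal{H})$ of the form $\mathcal{E}(\rho)=\sum_k E_k\rho E_k^\dagger$ (finite sum) with $\sum_k E_k^\dagger E_k=I$. A measure-many one-way general quantum finite automaton (MM-1gQFA) is a tuple $\mathcal{M}=\{\mathcal{H},\Sigma,\rho_0,\{\mathcal{E}_\sigma\}_{\sigma\in\Sigma\cup\{\triangleright,\$\}},\mathcal{H}_{acc},\mathcal{H}_{rej}\}$ where $\mathcal{H}$ is a finite-dimensional Hilbert space, $\Sigma$ is a finite input alphabet, $\triangleright,\$\notin\Sigma$ are the left and right end-markers, each $\mathcal{E}_\sigma$ is a trace-preserving quantum operation acting on $\mathcal{H}$, $\mathcal{H}_{acc},\mathcal{H}_{rej}$ are subspaces of $\mathcal{H}$ which together with another subspace $\mathcal{H}_{non}$ give an orthogonal decomposition $\mathcal{H}=\mathcal{H}_{acc}\oplus\mathcal{H}_{rej}\oplus\mathcal{H}_{non}$, and $\rho_0$ (the initial state) is a density operator on $\mathcal{H}$ with $\mathrm{supp}(\rho_0)\subseteq\mathcal{H}_{non}$.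 $P_{non},P_{acc},P_{rej}$ denote the orthogonal projectors onto $\mathcal{H}_{non},\mathcal{H}_{acc},\mathcal{H}_{rej}$. On input $x\in\Sigma^*$ the machine reads $\triangleright x\$$. Its total state is a triple $(\rho,p_{acc},p_{rej})\in L(\mathcal{H})\times\mathbb{R}\times\mathbb{R}$, starting at $(\rho_0,0,0)$, and reading a symbol $\sigma$ transforms it by $$(\rho,p_{acc},p_{rej})\mapsto\big(P_{non}\mathcal{E}_\sigma(\rho)P_{non},\ \mathrm{Tr}(P_{acc}\mathcal{E}_\sigma(\rho))+p_{acc},\ \mathrm{Tr}(P_{rej}\mathcal{E}_\sigma(\rho))+p_{rej}\big).$$ The accepting probability $f_{\mathcal{M}}(x)$ is the component $p_{acc}$ after all of $\triangleright x\$$ has been read. A language $L\subseteq\Sigma^*$ is recognized by $\mathcal{M}$ with bounded error $\epsilon$ ($\epsilon>0$) if for some $\lambda\in(0,1]$, $f_{\mathcal{M}}(x)\ge\lambda+\epsilon$ for every $x\in L$ and $f_{\mathcal{M}}(y)\le\lambda-\epsilon$ for every $y\in\Sigma^*\setminus L$. A language is regular if it is accepted by a (deterministic) finite automaton. *)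

(* Defs.v *)
From HB Require Import structures.
From mathcomp Require Import all_boot all_order all_algebra.
From mathcomp Require Import reals.
From mathcomp Require Import complex.

Set Implicit Arguments.
Unset Strict Implicit.
Unset Printing Implicit Defensive.

Import Order.TTheory GRing.Theory Num.Theory.

Local Open Scope ring_scope.
Local Open Scope sesquilinear_scope.

(* A finite-dimensional complex Hilbert space is given in coordinates, as      *)
(* 'cV[C]_n with the inner product [hdot].  Operators are square matrices      *)
(* acting by [A *m v], and the adjoint of A is [A ^t*].                        *)
Section Hilbert.
Variable C : numClosedFieldType.

Definition hdot n (u v : 'cV[C]_n) : C := (v ^t* *m u) 0 0.

Fact hdot_bilinear n : bilinear_for *%R (Num.conj \; *%R) (@hdot n).
Proof.
split=> [v a u w|u a v w]; rewrite /hdot.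
  by rewrite mulmxDr -scalemxAr !mxE.
by rewrite linearP map_mxD map_mxZ mulmxDl -scalemxAl !mxE.
Qed.

HB.instance Definition _ n := bilinear_isBilinear.Build C 'cV[C]_n 'cV[C]_n C
  *%R (Num.conj \; *%R) (@hdot n) (@hdot_bilinear n).

Fact hdot_hermitian n (u v : 'cV[C]_n) :
  hdot u v = (-1) ^+ false * (hdot v u)^*.
Proof.
rewrite mul1r /hdot !mxE rmorph_sum; apply: eq_bigr => i _.
by rewrite !mxE rmorphM /= conjCK mulrC.
Qed.

HB.instance Definition _ n := isHermitianSesquilinear.Build C 'cV[C]_n
  false Num.conj (@hdot n) (@hdot_hermitian n).

Fact hdot_gt0 n (u : 'cV[C]_n) : u != 0 -> 0 < hdot u u.
Proof.
rewrite -trmx_eq0 => /(@dotmx_is_dotmx C n).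
by rewrite dotmxE /hdot !mxE; under eq_bigr do rewrite !mxE mulrC;
   under [X in _ -> 0 < X]eq_bigr do rewrite !mxE.
Qed.

HB.instance Definition _ n := isDotProduct.Build C 'cV[C]_n
  (@hdot n) (@hdot_gt0 n).

Definition orthogonal_vs n (U V : {vspace 'cV[C]_n}) : Prop :=
  (U <= orthov (@hdot n) V)%VS.

Definition orthogonal_decomposition n (U V W : {vspace 'cV[C]_n}) : Prop :=
  [/\ orthogonal_vs U V, orthogonal_vs U W, orthogonal_vs V W
    & (U + V + W = fullv)%VS].

(* Column j is the image of the j-th basis vector under the projection onto U  *)
(* along its orthogonal complement; see orthoprojP.                            *)
Definition orthoproj n (U : {vspace 'cV[C]_n}) : 'M[C]_n :=
  \matrix_(i, j) daddv_pi U (orthov (@hdot n) U) (delta_mx j 0) i 0.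

Lemma orthoprojE n (U : {vspace 'cV[C]_n}) (v : 'cV[C]_n) :
  orthoproj U *m v = daddv_pi U (orthov (@hdot n) U) v.
Proof.
rewrite [in RHS](matrix_sum_delta v) linear_sum; apply/colP => i.
rewrite !mxE summxE; apply: eq_bigr => j _.
by rewrite big_ord1 linearZ !mxE mulrC.
Qed.

Lemma capv_orthov n (U : {vspace 'cV[C]_n}) :
  (U :&: orthov (@hdot n) U = 0)%VS.
Proof.
apply/eqP; rewrite -subv0; apply/subvP => u.
rewrite memv_cap memv0 => /andP[Uu /mem_orthovP/(_ u Uu) uu0].
by apply/negPn/negP => /hdot_gt0; rewrite uu0 ltxx.
Qed.

Lemma addv_orthov n (U : {vspace 'cV[C]_n}) :
  (U + orthov (@hdot n) U = fullv)%VS.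
Proof.
apply/eqP; rewrite eqEsubv subvf; apply/subvP => v _.
have [u Uu [w [-> _ wU]]] := orthogonal_split (@hdot n) (vbasis U) v.
have eU := span_basis (vbasisP U); rewrite orthogonalE eU in wU.
rewrite eU in Uu; apply: memv_add => //.
by rewrite memvE -span_seq1.
Qed.

Lemma orthoprojP n (U : {vspace 'cV[C]_n}) (v : 'cV[C]_n) :
  orthoproj U *m v \in U /\ v - orthoproj U *m v \in orthov (@hdot n) U.
Proof.
rewrite orthoprojE memv_pi; split=> //.
rewrite -[v in v - _](daddv_pi_add (capv_orthov U) (w := v)) ?addv_orthov ?memvf //.
by rewrite addrAC subrr add0r memv_pi.
Qed.

Definition psdmx n (A : 'M[C]_n) : Prop :=
  forall v : 'cV[C]_n, 0 <= hdot (A *m v) v.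

Definition density n (A : 'M[C]_n) : Prop := psdmx A /\ \tr A = 1.

Definition nonzero_eigenvector n (A : 'M[C]_n) (v : 'cV[C]_n) : Prop :=
  v != 0 /\ exists2 a : C, a != 0 & A *m v = a *: v.

Definition supp n (A : 'M[C]_n) (v : 'cV[C]_n) : Prop :=
  exists2 s : seq 'cV[C]_n,
    {in s, forall u, nonzero_eigenvector A u} & v \in <<s>>%VS.

Definition tp_quantum_operation n (E : 'M[C]_n -> 'M[C]_n) : Prop :=
  exists (m : nat) (K : 'I_m -> 'M[C]_n),
    \sum_(k < m) (K k) ^t* *m K k = 1%:M /\
    forall rho, E rho = \sum_(k < m) K k *m rho *m (K k) ^t*.

End Hilbert.

Inductive endmarked (Sigma : Type) :=
  | LeftEnd
  | RightEnd
  | Letter of Sigma.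

Arguments LeftEnd {Sigma}.
Arguments RightEnd {Sigma}.

Definition language (Sigma : Type) := seq Sigma -> Prop.

Record mm1gqfa (R : realType) (Sigma : finType) := MM1gQFA {
  qdim : nat;
  rho0 : 'M[R[i]]_qdim;
  qop : endmarked Sigma -> 'M[R[i]]_qdim -> 'M[R[i]]_qdim;
  Hacc : {vspace 'cV[R[i]]_qdim};
  Hrej : {vspace 'cV[R[i]]_qdim};
  Hnon : {vspace 'cV[R[i]]_qdim};
  qop_tp : forall s, tp_quantum_operation (qop s);
  H_decomposition : orthogonal_decomposition Hacc Hrej Hnon;
  rho0_density : density rho0;
  rho0_supp : forall v, supp rho0 v -> v \in Hnon
}.

Arguments qop {R Sigma} _ _ _.

Section Semantics.
Variables (R : realType) (Sigma : finType) (M : mm1gqfa R Sigma).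

Definition total_state : Type := ('M[R[i]]_(qdim M) * R * R)%type.

(* The traces are nonnegative reals on reachable states; complex.Re only casts *)
(* them from R[i] to R.                                                        *)
Definition mm_step (st : total_state) (s : endmarked Sigma) : total_state :=
  let: (rho, pacc, prej) := st in
  let Pnon := orthoproj (Hnon M) in
  (Pnon *m qop M s rho *m Pnon,
   complex.Re (\tr (orthoproj (Hacc M) *m qop M s rho)) + pacc,
   complex.Re (\tr (orthoproj (Hrej M) *m qop M s rho)) + prej).

Definition mm_run (x : seq Sigma) : total_state :=
  foldl mm_step (rho0 M, 0, 0) (LeftEnd :: rcons (map (@Letter _) x) RightEnd).

Definition accept_prob (x : seq Sigma) : R := (mm_run x).1.2.

Definition recognizes_with_bounded_error (eps : R) (L : language Sigma) : Prop :=
  0 < eps /\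
  exists2 lambda : R, 0 < lambda <= 1 &
    (forall x, L x -> lambda + eps <= accept_prob x) /\
    (forall y, ~ L y -> accept_prob y <= lambda - eps).

End Semantics.

Record dfa (Sigma : finType) := DFA {
  dfa_state : finType;
  dfa_start : dfa_state;
  dfa_trans : dfa_state -> Sigma -> dfa_state;
  dfa_final : {set dfa_state}
}.

Arguments dfa_trans {Sigma} _ _ _.

Definition dfa_accepts (Sigma : finType) (A : dfa Sigma) (x : seq Sigma) : bool :=
  foldl (dfa_trans A) (dfa_start A) x \in dfa_final A.

Definition regular (Sigma : finType) (L : language Sigma) : Prop :=
  exists A : dfa Sigma, forall x, L x <-> dfa_accepts A x.

(* Main.v *)
(* On input x z the accepting probability is p_x + Re tr (A_z rho_x), where p_x *)
(* and rho_x are the accepting component and the unnormalized state after       *)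
(* reading the left end-marker and x, and the effect 0 <= A_z <= 1 is obtained  *)
(* by pulling acceptance back along z and the right end-marker.  The entries of *)
(* A_z and rho_x are bounded, so if A_z and A_z' are close enough then x z and  *)
(* x z' have accepting probabilities less than 2 eps apart, for all x at once.  *)
(* Splitting the bounded set of effects into finitely many small cells          *)
(* therefore leaves L with finitely many right contexts.                        *)

Require Import Defs.
From mathcomp Require Import all_boot all_order all_algebra.
From mathcomp Require Import reals.
From mathcomp Require Import boolp classical_sets complex ring lra.

Set Implicit Arguments.
Unset Strict Implicit.
Unset Printing Implicit Defensive.

Import Order.TTheory GRing.Theory Num.Theory.

Local Open Scope ring_scope.
Local Open Scope sesquilinear_scope.

(** Two bounds hold uniformly in the word read: a pulled-back effect satisfies 0 <= A <= 1
    ([accept_effect]), and an unnormalized state is positive of trace at most 1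
    ([unnormalized_state]). Either way the diagonal entries are at most 1, so [psdmx_entry_le]
    bounds all entries by 2. [finite_matrix_buckets] then gives each suffix one of finitely many
    colours, [trace_mul_le] turns closeness of effects into closeness of probabilities, and the
    error gap keeps L from separating equally coloured suffixes after any prefix.
    [regular_of_finite_contexts] builds the automaton. *)

Section Operators.
Variable C : numClosedFieldType.

(** * Positive semidefinite matrices and bounds on their entries *)

Lemma trmxC_mul m n p (A : 'M[C]_(m, n)) (B : 'M[C]_(n, p)) :
  (A *m B) ^t* = B ^t* *m A ^t*.
Proof. by rewrite trmx_mul map_mxM. Qed.

Lemma hdot_mulmx_adj n (A : 'M[C]_n) u v :
  hdot (A *m u) v = hdot u (A ^t* *m v).
Proof. by rewrite /hdot trmxC_mul trmxCK mulmxA. Qed.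

Lemma hdot_delta n (A : 'M[C]_n) i j :
  hdot (A *m delta_mx j 0) (delta_mx i 0) = A i j.
Proof.
rewrite /hdot -colE mxE (bigD1 i) //= big1 => [|k ki].
  by rewrite !mxE !eqxx /= conjC1 mul1r addr0.
by rewrite !mxE (negPf ki) /= conjC0 mul0r.
Qed.

Lemma hdot_ge0 n (u : 'cV[C]_n) : 0 <= hdot u u.
Proof.
have [->|/hdot_gt0/ltW //] := eqVneq u 0.
by rewrite /hdot mulmx0 mxE.
Qed.

Lemma psdmx0 n : psdmx (0 : 'M[C]_n).
Proof. by move=> v; rewrite mul0mx /hdot mulmx0 mxE. Qed.

Lemma psdmxD n (A B : 'M[C]_n) : psdmx A -> psdmx B -> psdmx (A + B).
Proof.
move=> hA hB v; rewrite mulmxDl /hdot mulmxDr mxE.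
exact: addr_ge0 (hA v) (hB v).
Qed.

Lemma psdmx_sum n (I : finType) (F : I -> 'M[C]_n) :
  (forall i, psdmx (F i)) -> psdmx (\sum_i F i).
Proof. by move=> hF; apply: big_ind => // [|A B]; [exact: psdmx0 | exact: psdmxD]. Qed.

Lemma psdmx_congr n (A K : 'M[C]_n) : psdmx A -> psdmx (K *m A *m K ^t*).
Proof.
by move=> hA v; rewrite -!mulmxA hdot_mulmx_adj; exact: hA.
Qed.

Lemma psdmx_projector n (P : 'M[C]_n) : P ^t* *m P = P -> psdmx P.
Proof.
by move=> hP v; rewrite -hP -mulmxA hdot_mulmx_adj trmxCK hdot_ge0.
Qed.

(** Since Q Q = Q, the matrix 1 - P - Q A Q equals (1 - P - Q) + Q (1 - A) Q. *)
Lemma psdmx_compression_compl n (P Q A : 'M[C]_n) :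
  Q ^t* = Q -> Q *m Q = Q -> psdmx (1%:M - P - Q) -> psdmx (1%:M - A) ->
  psdmx (1%:M - (P + Q *m A *m Q)).
Proof.
move=> QH QQ hPQ /(psdmx_congr Q) hA; have := psdmxD hPQ hA.
rewrite QH mulmxBr mulmxBl mulmx1 QQ.
by rewrite addrA subrK opprD addrA.
Qed.

Lemma psdmx_diag_ge0 n (A : 'M[C]_n) i : psdmx A -> 0 <= A i i.
Proof. by move=> hA; rewrite -hdot_delta; exact: hA. Qed.

Lemma psdmx_trace_ge0 n (A : 'M[C]_n) : psdmx A -> 0 <= \tr A.
Proof. by move=> hA; apply: sumr_ge0 => i _; exact: psdmx_diag_ge0. Qed.

Lemma psdmx_diag_le_trace n (A : 'M[C]_n) i : psdmx A -> A i i <= \tr A.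
Proof.
move=> hA; rewrite /mxtrace (bigD1 i) //= lerDl.
by apply: sumr_ge0 => j _; exact: psdmx_diag_ge0.
Qed.

Lemma ler_norm_of_pm (d s : C) : 0 <= d + s -> 0 <= d - s -> `|s| <= d.
Proof.
move=> h1 h2; rewrite -(@ler_pM2l _ 2) // -[X in X * _]ger0_norm // -normrM.
have -> : 2 * s = (d + s) - (d - s) by ring.
rewrite (le_trans (ler_normB _ _)) // !ger0_norm //.
by rewrite (_ : d + s + (d - s) = 2 * d) //; ring.
Qed.

(* Testing positivity on [e_i + c e_j] with c = 1, -1, 'i, -'i bounds both      *)
(* |A i j + A j i| and |A i j - A j i| by A i i + A j j.                        *)
Lemma psdmx_entry_le n (A : 'M[C]_n) i j :
  psdmx A -> (forall k, A k k <= 1) -> `|A i j| <= 2.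
Proof.
move=> hA h1.
pose d := A i i + A j j.
have d2 : d <= 2 by rewrite /d (_ : 2 = 1 + 1) // lerD.
have q (c : C) : c * c^* = 1 -> 0 <= d + (c * A i j + c^* * A j i).
  move=> cc; have := hA (delta_mx i 0 + c *: delta_mx j 0).
  rewrite mulmxDr -scalemxAr linearDl !linearDr /= !linearZl_LR /= !linearZr_LR /=.
  rewrite !hdot_delta.
  suff -> : A i i + c^* * A j i + (c * A i j + c * (c^* * A j j))
      = d + (c * A i j + c^* * A j i) by [].
  by rewrite mulrA cc /d; ring.
have hs : `|A i j + A j i| <= d.
  apply: ler_norm_of_pm.
    by have := q 1; rewrite conjC1 !mul1r; apply.
  by have := q (-1); rewrite rmorphN /= conjC1 mulrNN !mulN1r mul1r opprD; apply.
(* The factor 'i makes the purely imaginary difference real, as [ler_norm_of_pm] requires. *)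
have ht : `|'i * A i j - 'i * A j i| <= d.
  have ii : 'i * - 'i = 1 :> C by rewrite mulrN -expr2 sqrCi opprK.
  apply: ler_norm_of_pm.
    by have := q 'i; rewrite conjCi mulNr; apply.
  have := q (- 'i); rewrite rmorphN /= conjCi opprK mulrC ii mulNr.
  by rewrite opprB [- _ + _]addrC; apply.
have e : 2 * A i j = (A i j + A j i) - 'i * ('i * A i j - 'i * A j i).
  rewrite mulrBr !mulrA -expr2 sqrCi; ring.
rewrite -(@ler_pM2l _ 2) // -[X in X * `|_|]ger0_norm // -normrM e.
rewrite (le_trans (ler_normB _ _)) // normrM normCi mul1r.
by rewrite (_ : 2 * 2 = 2 + 2) ?lerD ?(le_trans _ d2) //; ring.
Qed.

Lemma trace_mul_le n (A B : 'M[C]_n) (a b : C) :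
  (forall i j, `|A i j| <= a) -> (forall i j, `|B i j| <= b) ->
  `|\tr (A *m B)| <= a * b *+ (n * n).
Proof.
move=> hA hB; rewrite (le_trans (ler_norm_sum _ _ _)) //.
apply: (@le_trans _ _ (\sum_(i < n) a * b *+ n)).
  apply: ler_sum => i _; rewrite mxE (le_trans (ler_norm_sum _ _ _)) //.
  rewrite (le_trans (ler_sum _ _ (G := fun=> a * b))) // => [k _|].
    by rewrite normrM ler_pM.
  by rewrite sumr_const card_ord.
by rewrite sumr_const card_ord mulrnA.
Qed.

(** * Algebra of orthogonal projectors *)

Section Projectors.
Variable n : nat.
Implicit Types U V : {vspace 'cV[C]_n}.

(** The entries of P^* (1 - P) are inner products of a vector orthogonal to U with a vector of U.
    Hermitian symmetry and idempotence both follow from this identity. *)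
Lemma orthoproj_adj_mul U :
  (orthoproj U) ^t* *m orthoproj U = (orthoproj U) ^t*.
Proof.
set P := orthoproj U.
suff : P ^t* *m (1%:M - P) = 0.
  by rewrite mulmxBr mulmx1 => /eqP; rewrite subr_eq0 => /eqP.
apply/matrixP => i j; rewrite -hdot_delta mxE -mulmxA hdot_mulmx_adj trmxCK.
rewrite mulmxBl mul1mx.
have [_ /mem_orthovP] := orthoprojP U (delta_mx j 0); apply.
by have [] := orthoprojP U (delta_mx i 0).
Qed.

Lemma orthoproj_hermitian U : (orthoproj U) ^t* = orthoproj U.
Proof.
by have /(congr1 (fun X => X ^t*)) := orthoproj_adj_mul U;
  rewrite trmxC_mul !trmxCK orthoproj_adj_mul.
Qed.

Lemma orthoproj_idem U : orthoproj U *m orthoproj U = orthoproj U.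
Proof. by rewrite -{1}orthoproj_hermitian orthoproj_adj_mul orthoproj_hermitian. Qed.

Lemma orthoproj_mul_orthogonal U V :
  orthogonal_vs U V -> orthoproj V *m orthoproj U = 0.
Proof.
move=> /subvP UV; rewrite -[orthoproj V]orthoproj_hermitian.
apply/matrixP => i j; rewrite -hdot_delta mxE -mulmxA hdot_mulmx_adj trmxCK.
have [/UV/mem_orthovP + _] := orthoprojP U (delta_mx j 0); apply.
by have [] := orthoprojP V (delta_mx i 0).
Qed.

Lemma psdmx_orthoproj U : psdmx (orthoproj U).
Proof. by apply: psdmx_projector; rewrite orthoproj_hermitian orthoproj_idem. Qed.

Lemma psdmx_orthoproj_compl U V :
  orthogonal_vs U V -> psdmx (1%:M - orthoproj U - orthoproj V).
Proof.
move=> /orthoproj_mul_orthogonal VU.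
have UV : orthoproj U *m orthoproj V = 0.
  rewrite -(orthoproj_hermitian U) -(orthoproj_hermitian V) -trmxC_mul VU.
  by rewrite trmx0 map_mx0.
apply: psdmx_projector.
have -> : (1%:M - orthoproj U - orthoproj V) ^t*
    = 1%:M - orthoproj U - orthoproj V.
  rewrite !linearB /= !map_mxB trmx1 map_mx1.
  by rewrite -[in RHS](orthoproj_hermitian U) -[in RHS](orthoproj_hermitian V).
rewrite !mulmxBl !mulmxBr !mul1mx !mulmx1 !orthoproj_idem UV VU.
by rewrite !(subrr, subr0).
Qed.

End Projectors.
End Operators.

(** * Regularity from finitely many right contexts *)

(* A right-context classification suffices, with no congruence hypothesis: the  *)
(* state reached on x records, for each class t, whether L contains x followed  *)
(* by a representative of t, and reading a shifts the class of z to that of a z. *)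
Lemma regular_of_finite_contexts (Sigma : finType) (L : language Sigma)
    (T : finType) (c : seq Sigma -> T) :
  (forall z z', c z = c z' -> forall x, L (x ++ z) -> L (x ++ z')) ->
  regular L.
Proof.
move=> hc.
(* A class that is not attained gets the default word [::]; the transition rule below is valid for
   any choice there. *)
pose rep t := xget [::] [set z | c z = t]%classic.
have crep z : c (rep (c z)) = c z.
  by apply: (@xgetPex _ [::] [set z' | c z' = c z]%classic); exists z.
pose st x : {ffun T -> bool} := [ffun t => `[< L (x ++ rep t) >]].
have stE x z : st x (c z) = `[< L (x ++ z) >].
  by rewrite ffunE; apply/asboolP/asboolP; apply: hc; rewrite crep.
pose A := @DFA Sigma {ffun T -> bool} (st [::])
  (fun s a => [ffun t => s (c (a :: rep t))]) [set s : {ffun T -> bool} | s (c [::])].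
have run x : foldl (dfa_trans A) (dfa_start A) x = st x.
  elim/last_ind: x => // x a IH; rewrite -cats1 foldl_cat IH /=.
  by apply/ffunP => t; rewrite ffunE stE ffunE -catA.
exists A => x; rewrite /dfa_accepts run inE stE cats0.
by split=> /asboolP.
Qed.

(** * Finite partitions of bounded sets into small cells *)

Lemma finite_buckets (R : realType) (b e : R) : 0 < e ->
  exists (T : finType) (c : R -> T), forall x y, `|x| <= b -> `|y| <= b ->
    c x = c y -> `|x - y| < e.
Proof.
(* [g x] numbers the half-open cell of width e, counted from -b, that contains x. *)
move=> e0; pose g x := Num.truncn ((x + b) / e).
have gP x : `|x| <= b -> (g x)%:R <= (x + b) / e < (g x).+1%:R.
  move=> /ler_normlP[xb _]; apply: truncn_itv.
  by apply: divr_ge0; lra.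
pose N := Num.truncn ((b + b) / e).
have gN x : `|x| <= b -> (g x < N.+1)%N.
  move=> /ler_normlP[_ xb]; rewrite ltnS le_truncn //.
  by rewrite ler_wpM2r ?lerD2r // invr_ge0 ltW.
exists 'I_N.+1, (fun x => inord (g x)) => x y hx hy /(congr1 (@nat_of_ord _)).
rewrite !inordK ?gN // => gxy.
have := gP _ hx; have := gP _ hy; rewrite gxy -natr1.
rewrite !ler_pdivlMr // !ltr_pdivrMr // => /andP[y1 y2] /andP[x1 x2].
by rewrite ltr_norml; apply/andP; split; lra.
Qed.

Section ComplexMatrices.
Variables (R : realType) (n : nat).

Lemma ReD (x y : R[i]) : complex.Re (x + y) = complex.Re x + complex.Re y.
Proof. by case: x y => [? ?] [? ?]. Qed.

Lemma normc_ge_Im (z : R[i]) : `|complex.Im z|%:C%C <= `|z|.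
Proof.
rewrite -normrN -ReiNIm (le_trans (normc_ge_Re _)) // normrM.
by rewrite (_ : `|'i%C| = 1) ?mulr1 //; exact: normCi.
Qed.

Lemma normc_le_ReIm (z : R[i]) :
  `|z| <= (`|complex.Re z| + `|complex.Im z|)%:C%C.
Proof.
rewrite {1}[z]complexE (le_trans (ler_normD _ _)) // normrM.
rewrite (_ : `|'i%C| = 1) ?mul1r; last exact: normCi.
by rewrite !normc_def /= !expr0n /= !addr0 !sqrtr_sqr rmorphD.
Qed.

Lemma finite_matrix_buckets (b e : R) : 0 < e ->
  exists (T : finType) (c : 'M[R[i]]_n -> T), forall A B : 'M[R[i]]_n,
    (forall i j, `|A i j| <= b%:C%C) -> (forall i j, `|B i j| <= b%:C%C) ->
    c A = c B -> forall i j, `|(A - B) i j| <= e%:C%C.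
Proof.
(* Real and imaginary parts get half of the tolerance each. *)
move=> e0; have e20 : 0 < e / 2 by rewrite divr_gt0.
have [T [c hc]] := finite_buckets b e20.
exists {ffun 'I_n * 'I_n -> T * T}.
exists (fun A : 'M[R[i]]_n => [ffun p => (c (complex.Re (A p.1 p.2)), c (complex.Im (A p.1 p.2)))]).
move=> A B hA hB /ffunP cAB i j.
have := cAB (i, j); rewrite !ffunE /= => -[cre cim].
have hre (D : 'M[R[i]]_n) : (forall i j, `|D i j| <= b%:C%C) -> `|complex.Re (D i j)| <= b.
  by move=> hD; rewrite -lecR (le_trans (normc_ge_Re _)).
have him (D : 'M[R[i]]_n) : (forall i j, `|D i j| <= b%:C%C) -> `|complex.Im (D i j)| <= b.
  by move=> hD; rewrite -lecR (le_trans (normc_ge_Im _)).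
have := hc _ _ (hre _ hA) (hre _ hB) cre.
have := hc _ _ (him _ hA) (him _ hB) cim.
rewrite !mxE => h1 h2; rewrite (le_trans (normc_le_ReIm _)) // lecR.
rewrite !raddfB /=; lra.
Qed.

End ComplexMatrices.

(** * Effects and unnormalized states of the automaton *)

Section Automaton.
Variables (R : realType) (Sigma : finType) (M : mm1gqfa R Sigma).
Implicit Types (w : seq (endmarked Sigma)) (A rho : 'M[R[i]]_(qdim M)).

Let Pacc := orthoproj (Hacc M).
Let Pnon := orthoproj (Hnon M).

(* Heisenberg picture: with [qop s] given by Kraus operators K, the effect of   *)
(* s :: w is the sum of K^* (Pacc + Pnon A Pnon) K, where A is the effect of w. *)
Lemma accept_effect w : exists A,
  [/\ psdmx A, psdmx (1%:M - A)
    & forall rho p q, (foldl (@mm_step _ _ M) (rho, p, q) w).1.2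
        = complex.Re (\tr (A *m rho)) + p].
Proof.
elim: w => [|s w [A [A0 A1 hA]]].
  exists 0; split; [exact: psdmx0| |by move=> rho p q; rewrite mul0mx mxtrace0 add0r].
  by rewrite subr0; apply: psdmx_projector; rewrite trmx1 map_mx1 mulmx1.
have [m [K [K1 KE]]] := qop_tp M s.
pose B := Pacc + Pnon *m A *m Pnon.
have B0 : psdmx B.
  apply: psdmxD; first exact: psdmx_orthoproj.
  by rewrite -{2}[Pnon]orthoproj_hermitian; exact: psdmx_congr.
have B1 : psdmx (1%:M - B).
  have /psdmx_orthoproj_compl h : orthogonal_vs (Hacc M) (Hnon M).
    by have [] := H_decomposition M.
  exact: (psdmx_compression_compl (orthoproj_hermitian _) (orthoproj_idem _) h A1).
exists (\sum_(k < m) (K k) ^t* *m B *m K k); split.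
- apply: psdmx_sum => k; rewrite -{2}[K k]trmxCK; exact: psdmx_congr.
(* As the K^* K sum to 1, the complement of the new effect is the sum of the K^* (1 - B) K. *)
- rewrite -K1 -sumrB; apply: psdmx_sum => k.
  rewrite (_ : _ - _ = (K k) ^t* *m (1%:M - B) *m K k); last first.
    by rewrite mulmxBr mulmxBl mulmx1.
  rewrite -{2}[K k]trmxCK; exact: psdmx_congr.
- move=> rho p q /=; rewrite hA addrA; congr (_ + _).
  rewrite -ReD; congr (complex.Re _); set sg := qop M s rho.
  have -> : \tr (A *m (Pnon *m sg *m Pnon)) = \tr (Pnon *m A *m Pnon *m sg).
    by rewrite mulmxA mxtrace_mulC !mulmxA.
  rewrite addrC -mxtraceD -mulmxDl -/B /sg KE mulmx_sumr mulmx_suml !raddf_sum.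
  by apply: eq_bigr => k _; rewrite /= !mulmxA mxtrace_mulC !mulmxA.
Qed.

(** The operation preserves the trace, and compressing by P = [Pnon] loses exactly the trace of the
    positive matrix (1 - P) sg (1 - P). *)
Lemma unnormalized_state w :
  let rho := (foldl (@mm_step _ _ M) (rho0 M, 0, 0) w).1.1 in
  psdmx rho /\ \tr rho <= 1.
Proof.
elim/last_ind: w => [|w s].
  by have [r0 r1] := rho0_density M; rewrite /= r1.
rewrite -cats1 foldl_cat; case: (foldl _ _ w) => [[rho p] q] /= [r0 r1].
have [m [K [K1 KE]]] := qop_tp M s.
rewrite -/Pnon; set sg := qop M s rho.
have s0 : psdmx sg by rewrite /sg KE; apply: psdmx_sum => k; exact: psdmx_congr.
have s1 : \tr sg <= 1.
  rewrite (le_trans _ r1) // le_eqVlt; apply/orP; left; apply/eqP.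
  rewrite /sg KE -[in RHS](mul1mx rho) -K1 mulmx_suml !raddf_sum /=.
  by apply: eq_bigr => k _; rewrite mxtrace_mulC !mulmxA.
have PH : Pnon ^t* = Pnon by exact: orthoproj_hermitian.
have PP : Pnon *m Pnon = Pnon by exact: orthoproj_idem.
split; first by rewrite -{2}PH; exact: psdmx_congr.
apply: le_trans s1; rewrite -subr_ge0.
have QH : (1%:M - Pnon) ^t* = 1%:M - Pnon.
  by rewrite linearB /= map_mxB trmx1 map_mx1 -[in RHS]PH.
have -> : \tr sg - \tr (Pnon *m sg *m Pnon)
    = \tr ((1%:M - Pnon) *m sg *m (1%:M - Pnon) ^t*).
  have comp X : X *m X = X -> \tr (X *m sg *m X) = \tr (X *m sg).
    by move=> XX; rewrite mxtrace_mulC mulmxA XX.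
  have QQ : (1%:M - Pnon) *m (1%:M - Pnon) = 1%:M - Pnon.
    by rewrite mulmxBr mulmx1 mulmxBl mul1mx PP subrr subr0.
  by rewrite QH (comp _ PP) (comp _ QQ) mulmxBl mul1mx raddfB.
by apply: psdmx_trace_ge0; exact: psdmx_congr.
Qed.

End Automaton.

Theorem theorem16 (R : realType) (Sigma : finType) (L : language Sigma) :
  (exists (M : mm1gqfa R Sigma) (eps : R), recognizes_with_bounded_error M eps L) ->
  regular L.
Proof.
move=> [M [eps [eps0 [lambda _ [hL hN]]]]].
have [eff heff] := choice (fun w => accept_effect M w).
pose tail z := rcons (map (@Letter Sigma) z) RightEnd.
have entry2 (rho : 'M[R[i]]_(qdim M)) : psdmx rho -> \tr rho <= 1 -> forall i j, `|rho i j| <= 2 :> R[i].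
  move=> r0 r1 i j; apply: psdmx_entry_le => // k.
  exact: le_trans (psdmx_diag_le_trace k r0) r1.
have eff2 w i j : `|eff w i j| <= 2 :> R[i].
  have [A0 A1 _] := heff w; apply: psdmx_entry_le => // k.
  by have := psdmx_diag_ge0 k A1; rewrite !mxE eqxx subr_ge0.
(* [trace_mul_le] with entry bounds d and 2 gives 2 d n^2; the + 1 makes this strictly less than eps
   and keeps the denominator positive. *)
pose n := qdim M; pose d : R := eps / (2 * (n * n)%:R + 1).
have d0 : 0 < d by rewrite divr_gt0 // ltr_wpDl // mulr_ge0.
have [T [c hc]] := finite_matrix_buckets n 2 d0.
apply: (@regular_of_finite_contexts _ _ T (fun z => c (eff (tail z)))) => z z' cz x.
apply: contraPP => Lxz' Lxz.
have hc' : forall i j, `|(eff (tail z) - eff (tail z')) i j| <= d%:C%C.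
  by apply: hc => // i j; rewrite (le_trans (eff2 _ _ _)) // rmorph_nat.
have runE y : accept_prob M (x ++ y)
    = (foldl (@mm_step _ _ M) (rho0 M, 0, 0) ((LeftEnd :: map (@Letter _) x) ++ tail y)).1.2.
  by rewrite /accept_prob /mm_run map_cat rcons_cat.
have := hL _ Lxz; have := hN _ Lxz'; rewrite !runE !foldl_cat.
have := unnormalized_state M (LeftEnd :: map (@Letter _) x).
case: (foldl _ _ (LeftEnd :: _)) => [[rho p] q] /= [r0 r1].
have [_ _ ->] := heff (tail z); have [_ _ ->] := heff (tail z') => h1 h2.
have := trace_mul_le hc' (entry2 _ r0 r1).
rewrite mulmxBl raddfB /= => h3.
have := le_trans (normc_ge_Re _) h3.
rewrite -(rmorph_nat (real_complex R)) -rmorphM -rmorphMn lecR raddfB /=.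
move=> /ler_normlP[_]; rewrite -/n => h4.
have h5 : d * 2 *+ (n * n) < eps.
  rewrite -mulr_natr -mulrA /d mulrAC ltr_pdivrMr ?ltr_wpDl ?mulr_ge0 //.
  by rewrite ltr_pM2l // ltrDl.
(* The common [p] and [lambda] cancel: [h1] and [h2] force a gap of at least 2 eps, while [h4] and
   [h5] leave less than eps. *)
lra.
Qed.
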